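(* Let $n,d\ge 1$ and consider the family of states $\mathcal Q_{n,d}=\{\rho^{\otimes n}:\rho\in\mathcal S(\mathbb C^d)\}$ on $(\mathbb C^d)^{\otimes n}$. Weak Schur sampling $M^{\mathrm{WSS}}=\{\Pi_\lambda:\lambda\in\mathbb Y_{n,d}\}$ is quantum-to-classically sufficient for $\mathcal Q_{n,d}$ relative to the class of $U(d)$-invariant POVMs. In particular, for every $U(d)$-invariant POVM $N$ on $(\mathbb C^d)^{\otimes n}$ with outcome space $(\mathsf Y,\mathcal Y)$ there exists a Markov kernel $K_N$ from $\mathbb Y_{n,d}$ to $(\mathsf Y,\mathcal Y)$, not depending on $\rho$, such that $$\operatorname{Tr}[\rho^{\otimes n}N(B)]=\sum_{\lambda\in\mathbb Y_{n,d}}K_N(\lambda,B)\operatorname{Tr}[\rho^{\otimes n}\Pi_\lambda]\qquad\text{for every }\rho\in\mathcal S(\mathbb C^d),\ B\in\mathcal Y.$$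
   Context: $\mathcal S(\mathbb C^d)$ is the set of density operators on $\mathbb C^d$. **Schur–Weyl blocks.** $\mathbb Y_{n,d}$ is the set of partitions $\lambda=(\lambda_1\ge\dots\ge\lambda_d\ge0)$ of $n$ into at most $d$ nonzero parts. Under the commuting actions of $U(d)$ by $U\mapsto U^{\otimes n}$ and of $S_n$ by permutation of tensor factors, Schur–Weyl duality gives $(\mathbb C^d)^{\otimes n}\cong\bigoplus_{\lambda\in\mathbb Y_{n,d}}\mathcal U_\lambda\otimes\mathcal V_\lambda$, with $\mathcal U_\lambda$ an irreducible $U(d)$-module and $\mathcal V_\lambda$ an irreducible $S_n$-module. $\Pi_\lambda$ is the orthogonal projection onto $\mathcal U_\lambda\otimes\mathcal V_\lambda$. **POVMs and sufficiency.** A POVM $M$ with (standard Borel) outcome space $(\mathsf Y,\mathcal Y)$ is a map from $\mathcal Y$ to positive bounded operators that is countably additive in the weak operator topology with $M(\mathsf Y)=I$. It is $U(d)$-invariant if $(U^{\otimes n})^\dagger M(B)U^{\otimes n}=M(B)$ for all $U\in U(d)$ and $B\in\mathcal Y$. For a family of states $\{\sigma_\theta\}$ put $P_\theta^M(B)=\operatorname{Tr}[\sigma_\theta M(B)]$. A measurement $M^\star$ in a class $\mathfrak M$ of POVMs is *quantum-to-classically sufficient* for the family relative to $\mathfrak M$ if for every $N\in\mathfrak M$ there is a parameter-independent Markov kernel $K_N$ from the outcome space of $M^\star$ to that of $N$ with $P_\theta^N(B)=\int K_N(x,B)P_\theta^{M^\star}(dx)$ for all $\theta$ and $B$. *)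

(* Defs.v *)
From HB Require Import structures.
From mathcomp Require Import all_boot all_order all_fingroup all_algebra.
From mathcomp Require Import complex.
From mathcomp Require Import all_classical all_reals all_analysis.

Set Implicit Arguments.
Unset Strict Implicit.
Unset Printing Implicit Defensive.

Import Order.TTheory GRing.Theory Num.Theory.
Import numFieldNormedType.Exports.

Local Open Scope classical_set_scope.
Local Open Scope ring_scope.
Local Open Scope sesquilinear_scope.

(* The partitions of n into at most d nonzero parts, padded with zeros to
   length d; a part of such a partition is at most n. *)
Definition is_partition (n d : nat) (l : d.-tuple 'I_n.+1) : bool :=
  sorted geq (map val l) && (sumn (map val l) == n).

Record young (n d : nat) :=
  Young { young_parts : d.-tuple 'I_n.+1; _ : is_partition young_parts }.

HB.instance Definition _ n d := [isSub for @young_parts n d].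
HB.instance Definition _ n d := [Finite of young n d by <:].

Section YoungPointed.
Variables n d : nat.

Let trivial_parts : d.+1.-tuple 'I_n.+1 := [tuple of ord_max :: nseq d ord0].

Let trivial_partsP : is_partition trivial_parts.
Proof.
rewrite /is_partition /= map_nseq sumn_nseq mul0n addn0 eqxx andbT.
by elim: d (n) => //= k IHk m; rewrite /geq /= IHk.
Qed.

HB.instance Definition _ := isPointed.Build (young n d.+1) (Young trivial_partsP).

End YoungPointed.

HB.instance Definition _ n d := @isMeasurable.Build default_measure_display
  (young n d.+1) discrete_measurable discrete_measurable0
  discrete_measurableC discrete_measurableU.

Definition young_shape n d (l : young n d) : seq nat := map val (young_parts l).

(* Y is Borel isomorphic to a Polish space P.  Both are nonempty by the
   library's conventions; the empty space carries no POVM on a nonzero Hilbert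
   space anyway. *)
Definition standard_borel (R : realType) dY (Y : measurableType dY) : Prop :=
  exists P : completePseudoMetricType R,
    [/\ hausdorff_space P,
        exists2 A : set P, countable A & dense A &
        exists2 f : Y -> P, bijective f &
          forall B : set Y, measurable B <-> <<s @open P >> (f @` B)].

Section Operators.
Variable R : realType.
Implicit Types N : nat.

(* Operators act on column vectors. *)
Definition positive_op N (A : 'M[R[i]]_N) : Prop :=
  forall x : 'cV[R[i]]_N, 0 <= (x^t* *m A *m x) 0 0.

Definition density_op N (rho : 'M[R[i]]_N) : Prop :=
  positive_op rho /\ \tr rho = 1.

(* Only the values of M on measurable sets are meaningful; R[i]^o is R[i]
   with the topology of its norm. *)
Definition is_povm N dY (Y : measurableType dY) (M : set Y -> 'M[R[i]]_N) :
    Prop :=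
  [/\ standard_borel R Y,
      forall B, measurable B -> positive_op (M B),
      M [set: Y] = 1%:M &
      forall F : nat -> set Y, (forall k, measurable (F k)) ->
        trivIset [set: nat] F ->
        forall x y : 'cV[R[i]]_N,
          (fun m => (x^t* *m (\sum_(k < m) M (F k)) *m y) 0 0 : R[i]^o) @ \oo
            --> ((x^t* *m M (\bigcup_k F k) *m y) 0 0 : R[i]^o)].

(* For a state and a POVM the trace is real, so no information is lost in
   taking its real part. *)
Definition outcome_law N (sigma : 'M[R[i]]_N) dY (Y : measurableType dY)
    (M : set Y -> 'M[R[i]]_N) (B : set Y) : \bar R :=
  (complex.Re (\tr (sigma *m M B)))%:E.

Definition povm_class N : Type :=
  forall dY (Y : measurableType dY), (set Y -> 'M[R[i]]_N) -> Prop.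

Definition qc_sufficient N (Theta : Type) (sigma : Theta -> 'M[R[i]]_N)
    (MM : povm_class N) dX (X : measurableType dX)
    (M : set X -> 'M[R[i]]_N) : Prop :=
  MM dX X M /\
  forall dY (Y : measurableType dY) (L : set Y -> 'M[R[i]]_N), MM dY Y L ->
    exists K : R.-pker X ~> Y, forall theta (B : set Y), measurable B ->
      outcome_law (sigma theta) L B =
        (\int[outcome_law (sigma theta) M]_x K x B)%E.

End Operators.

Section TensorPower.
Variables (R : realType) (n d : nat).

(* (C^d)^{(x)n} has the basis e_f = e_(f 0) (x) ... (x) e_(f (n-1)) indexed by
   the functions f : 'I_n -> 'I_d; tidx i is the function with number i. *)
Definition tdim : nat := #|{ffun 'I_n -> 'I_d}|.

Definition tidx (i : 'I_tdim) : {ffun 'I_n -> 'I_d} := enum_val i.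

Definition tensor_power (A : 'M[R[i]]_d) : 'M[R[i]]_tdim :=
  \matrix_(i, j) \prod_(k < n) A (tidx i k) (tidx j k).

(* e_g |-> e_(g o s), that is, v_0 (x) ... (x) v_(n-1) is mapped to
   v_(s 0) (x) ... (x) v_(s (n-1)); as (s * t) k = t (s k) for permutations,
   this is multiplicative in s. *)
Definition perm_op (s : {perm 'I_n}) : 'M[R[i]]_tdim :=
  \matrix_(i, j) (tidx i == [ffun k => tidx j (s k)])%:R.

Definition unitary_invariant dY (Y : measurableType dY)
    (M : set Y -> 'M[R[i]]_tdim) : Prop :=
  forall U : 'M[R[i]]_d, U \is unitarymx ->
    forall B, measurable B ->
      (tensor_power U)^t* *m M B *m tensor_power U = M B.

Definition invariant_povm : povm_class R tdim :=
  fun dY Y M => @is_povm R tdim dY Y M /\ unitary_invariant M.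

(* The tableau of shape l filled row by row with 0, ..., n-1: the entry k is
   in row reshape_index and column reshape_offset. *)
Definition row_stab (l : young n d) : {set {perm 'I_n}} :=
  [set s : {perm 'I_n} | [forall k : 'I_n,
     reshape_index (young_shape l) (s k) == reshape_index (young_shape l) k]]%SET.

Definition col_stab (l : young n d) : {set {perm 'I_n}} :=
  [set s : {perm 'I_n} | [forall k : 'I_n,
     reshape_offset (young_shape l) (s k) == reshape_offset (young_shape l) k]]%SET.

(* The action of the Young symmetrizer c_l on the tensor space. *)
Definition young_symmetrizer (l : young n d) : 'M[R[i]]_tdim :=
  (\sum_(s in row_stab l) perm_op s) *m
  (\sum_(s in col_stab l) (-1) ^+ s *: perm_op s).

(* The Schur-Weyl block U_l (x) V_l.  Here V_l is the Specht module
   C[S_n] c_l, and U_l = c_l (C^d)^{(x)n} is the Weyl module of highest weight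
   l.  Every S_n-equivariant map from V_l to the tensor space has the form
   a |-> a v for a tensor v, so the V_l-isotypic component is
   C[S_n] c_l (C^d)^{(x)n}: the sum over s of the column spaces of s c_l.
   Subspaces are row spaces in the library, hence the transpositions. *)
Definition schur_weyl_block (l : young n d) : 'M[R[i]]_tdim :=
  (\sum_(s : {perm 'I_n}) (perm_op s *m young_symmetrizer l)^T)%MS.

Definition schur_proj (l : young n d) : 'M[R[i]]_tdim :=
  (proj_ortho (schur_weyl_block l))^T.

Definition weak_schur_sampling (B : set (young n d)) : 'M[R[i]]_tdim :=
  \sum_(l : young n d | l \in B) schur_proj l.

Definition tensor_power_states (rho : {rho : 'M[R[i]]_d | density_op rho}) :
    'M[R[i]]_tdim :=
  tensor_power (sval rho).

End TensorPower.

Arguments invariant_povm : clear implicits.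
Arguments invariant_povm R n d [dY Y] M.
Arguments weak_schur_sampling R n d B : clear implicits.
Arguments tensor_power_states R n d rho : clear implicits.
Arguments schur_proj R [n d] l.

(* Main.v *)
(** Averaging an invariant effect over S_n leaves its expectation in rho^(x)n
    unchanged and makes it central: it commutes with all permutations and with
    all U^(x)n.  A central operator is determined by its diagonal entries at the
    tensors e_f.  Indeed, if these all vanish then tr(X^(x)n T) = 0 for X
    diagonal, hence for X hermitian by the spectral theorem, and then
    tr((X_1 (x) ... (x) X_n) T) = 0 for arbitrary X_k by polarization.  By
    symmetry the entry at f depends only on the sorted multiplicities of the
    values of f, which form a Young diagram.  So the center has dimension at most
    #|young n d|.  The Schur-Weyl projections Pi_l are central, and they are
    nonzero and pairwise orthogonal by the classical combinatorics of the Young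
    symmetrizers; therefore they form a basis of the center.  Expanding the
    averaged effect in this basis gives
      tr(rho^(x)n M) = sum_l (tr(M Pi_l) / tr(Pi_l)) tr(rho^(x)n Pi_l),
    and K(l, B) = tr(M(B) Pi_l) / tr(Pi_l) is the kernel. *)

Require Import Defs.
From HB Require Import structures.
From mathcomp Require Import all_boot all_order all_fingroup all_algebra.
From mathcomp Require Import complex.
From mathcomp Require Import all_classical all_reals all_analysis.
From mathcomp Require Import measurable_realfun.
From mathcomp Require Import ring.

Set Implicit Arguments.
Unset Strict Implicit.
Unset Printing Implicit Defensive.

Import Order.TTheory GRing.Theory Num.Theory.
Local Open Scope ring_scope.

(** * Young tableaux *)

Section YoungTableau.
Variables n d : nat.
Implicit Types l m : young n d.

Definition young_row l (k : 'I_n) : nat := reshape_index (young_shape l) k.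
Definition young_col l (k : 'I_n) : nat := reshape_offset (young_shape l) k.

Lemma size_young_shape l : size (young_shape l) = d.
Proof. by rewrite size_map size_tuple. Qed.

Lemma sumn_young_shape l : sumn (young_shape l) = n.
Proof. by have /andP[_ /eqP] := valP l. Qed.

Lemma sorted_young_shape l : sorted geq (young_shape l).
Proof. by have /andP[] := valP l. Qed.

Lemma young_shape_inj : injective (@young_shape n d).
Proof.
by move=> l m lm; do 2!apply: val_inj; apply: inj_map lm; exact: val_inj.
Qed.

Lemma young_shape_nonincr l i j :
  (i <= j)%N -> (nth 0 (young_shape l) j <= nth 0 (young_shape l) i)%N.
Proof.
(* Past the last row [nth] returns its default 0, so monotonicity extends to all indices. *)
move=> le_ij; have [j_lt|j_ge] := ltnP j (size (young_shape l)); last first.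
  by rewrite (nth_default _ j_ge).
have geq_trans : transitive geq by move=> a b c /= ab ca; exact: leq_trans ca ab.
apply: (sorted_leq_nth geq_trans _ 0%N (sorted_young_shape l)) => //.
  by move=> a /=.
by rewrite inE (leq_ltn_trans le_ij).
Qed.

Lemma ltn_young_row l k : (young_row l k < d)%N.
Proof.
by rewrite -(size_young_shape l) reshape_indexP // sumn_young_shape.
Qed.

Lemma ltn_young_col l k : (young_col l k < nth 0 (young_shape l) (young_row l k))%N.
Proof. by rewrite reshape_offsetP // sumn_young_shape. Qed.

Lemma young_col_ltn l k : (young_col l k < n)%N.
Proof. by rewrite (leq_ltn_trans _ (ltn_ord k)) // leq_subr. Qed.

Definition young_rowO l k : 'I_d := Ordinal (ltn_young_row l k).

Definition young_colO l k : 'I_n := Ordinal (young_col_ltn l k).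

Lemma young_box_inj l k k' :
  young_row l k = young_row l k' -> young_col l k = young_col l k' -> k = k'.
Proof.
move=> er ec; apply: val_inj => /=.
by rewrite -(reshape_indexK (young_shape l) k) -(reshape_indexK (young_shape l) k')
  -/(young_row l k) -/(young_col l k) er ec.
Qed.

Lemma young_box_exists l i c : (c < nth 0 (young_shape l) i)%N ->
  exists k, young_row l k = i /\ young_col l k = c.
Proof.
move=> lt_c; have := flatten_indexP lt_c; rewrite sumn_young_shape => lt_n.
by exists (Ordinal lt_n); rewrite /young_row /young_col /= flatten_indexKl
  // flatten_indexKr.
Qed.

Lemma card_young_row l i :
  #|[set k | young_row l k == i]%SET| = nth 0 (young_shape l) i.
Proof.
set r := nth _ _ _; have lt_n (c : 'I_r) : (flatten_index (young_shape l) i c < n)%N.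
  by rewrite -[X in (_ < X)%N](sumn_young_shape l) flatten_indexP.
rewrite -[RHS]card_ord -(card_imset (f := fun c => Ordinal (lt_n c)) predT).
  apply: eq_card => k; rewrite inE; apply/eqP/imsetP => [ri|[c _ ->]].
    have lt_r : (young_col l k < r)%N by rewrite /r -ri ltn_young_col.
    exists (Ordinal lt_r) => //; apply: val_inj => /=.
    by rewrite -ri reshape_indexK.
  by rewrite /young_row flatten_indexKl.
by move=> c c' /(congr1 val) /= /addnI /val_inj.
Qed.

(** Count by the columns of [m]. Boxes in one row of [l] go to distinct columns, so at most j boxes
    from the first j rows of [l] land in a given column; each column is compared with its part in
    the first j rows of [m]. *)
Lemma leq_card_young_dominance l m j (p : 'I_n -> 'I_n) : injective p ->
    (forall k k', young_row l k = young_row l k' ->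
       young_col m (p k) = young_col m (p k') -> k = k') ->
  (#|[set k | young_row l k < j]%SET| <= #|[set k | young_row m k < j]%SET|)%N.
Proof.
move=> p_inj lm_inj; rewrite -!sum1_card.
rewrite (partition_big (fun k => young_colO m (p k)) predT) //=.
rewrite [leqRHS](partition_big (young_colO m) predT) //=.
apply: leq_sum => c _; rewrite !sum1dep_card.
(* A column inside the first j rows is counted in full on the right, and [p] is injective. *)
have [/forallP c_short|] := boolP [forall k, (young_colO m k == c) ==> (young_row m k < j)%N].
  rewrite -(card_imset _ p_inj); apply/subset_leq_card/fintype.subsetP => x.
  case/imsetP => k; rewrite !inE => /andP[_ kc] ->.
  by rewrite kc andbT (implyP (c_short _)).
rewrite negb_forall => /existsP[x]; rewrite negb_imply -leqNgt => /andP[/eqP xc jx].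
(* Otherwise the column reaches a row of index at least j. The left count is at most j, one box per
   row of [l]; the right count is at least j, since each of the first j rows of [m] meets this
   column. *)
rewrite (@leq_trans j) //.
  rewrite -[leqRHS]card_ord.
  have rowj k : k \in [set k | (k \in [set k | (young_row l k < j)%N]%SET) &&
      (young_colO m (p k) == c)]%SET -> (young_row l k < j)%N.
    by rewrite !inE => /andP[].
  (* The case j = 0 is separate because [inord] needs a successor bound. *)
  case: j jx rowj => [|j] jx rowj.
    by rewrite card_ord leqn0 cards_eq0; apply/eqP/setP => k; rewrite !inE.
  rewrite -(@card_in_imset _ _ (fun k => inord (young_row l k) : 'I_j.+1)).
    exact: max_card.
  move=> k k' ks k's /(congr1 val) /=; rewrite !inordK ?rowj // => /lm_inj; apply.
  move: ks k's; rewrite !inE => /andP[_ /eqP/(congr1 val) /= ->].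
  by case/andP => _ /eqP/(congr1 val) /= ->.
have box (i : 'I_j) : exists k, young_row m k = i /\ young_col m k = c.
  apply: young_box_exists; rewrite -xc /=.
  apply: leq_trans (ltn_young_col m x) _; apply: young_shape_nonincr.
  exact: leq_trans (ltnW (ltn_ord i)) jx.
have [g g_box] := choice box.
have g_inj : injective g.
  move=> i i' gi; apply: val_inj => /=.
  by have [<- _] := g_box i; have [<- _] := g_box i'; rewrite gi.
rewrite -[leqLHS]card_ord -(card_imset predT g_inj); apply/subset_leq_card/fintype.subsetP => y.
case/imsetP => i _ ->; rewrite !inE; case: (g_box i) => -> gc; rewrite ltn_ord /=.
by apply/eqP/val_inj; rewrite /= gc.
Qed.

(** Row lengths are the differences of consecutive counts, and they determine the diagram. *)
Lemma eq_young_dominance l m :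
    (forall j, #|[set k | young_row l k < j]%SET| = #|[set k | young_row m k < j]%SET|)%N ->
  l = m.
Proof.
move=> lm; apply: young_shape_inj; apply: (@eq_from_nth _ 0%N).
  by rewrite !size_young_shape.
have row_card t i : (#|[set k | young_row t k < i.+1]%SET| =
    #|[set k | young_row t k < i]%SET| + #|[set k | young_row t k == i]%SET|)%N.
  rewrite -cardsUI [X in (_ + X)%N]eq_card0 ?addn0; last first.
    by move=> k; rewrite !inE; case: ltngtP.
  by apply: eq_card => k; rewrite !inE ltnS leq_eqVlt orbC.
move=> i _; rewrite -!card_young_row; apply/eqP.
by rewrite -(eqn_add2l #|[set k | (young_row l k < i)%N]%SET|) -row_card lm row_card lm.
Qed.

Lemma row_stabP l (s : {perm 'I_n}) :
  reflect (forall k, young_row l (s k) = young_row l k) (s \in row_stab l).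
Proof. by rewrite inE; exact: 'forall_eqP. Qed.

Lemma col_stabP l (s : {perm 'I_n}) :
  reflect (forall k, young_col l (s k) = young_col l k) (s \in col_stab l).
Proof. by rewrite inE; exact: 'forall_eqP. Qed.

Lemma group_set_row_stab l : group_set (row_stab l).
Proof.
apply/group_setP; split; first by apply/row_stabP => k; rewrite perm1.
by move=> s t /row_stabP sP /row_stabP tP; apply/row_stabP => k; rewrite permM tP sP.
Qed.
Canonical row_stab_group l := Group (group_set_row_stab l).

Lemma group_set_col_stab l : group_set (col_stab l).
Proof.
apply/group_setP; split; first by apply/col_stabP => k; rewrite perm1.
by move=> s t /col_stabP sP /col_stabP tP; apply/col_stabP => k; rewrite permM tP sP.
Qed.
Canonical col_stab_group l := Group (group_set_col_stab l).

Lemma row_col_stab1 l s : s \in row_stab l -> s \in col_stab l -> s = 1%g.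
Proof.
move=> /row_stabP sr /col_stabP sc; apply/permP => k; rewrite perm1.
exact: young_box_inj (sr k) (sc k).
Qed.

End YoungTableau.

(** * Normal form of label functions *)

Lemma perm_of_eq_fibers n (T : finType) (f g : 'I_n -> T) :
    (forall i, #|[set k | f k == i]%SET| = #|[set k | g k == i]%SET|) ->
  exists s : {perm 'I_n}, forall k, f k = g (s k).
Proof.
move=> fg; have : perm_eq [tuple f k | k < n] [tuple g k | k < n].
  apply/allP => x _ /=; rewrite !count_map -!sum1_count -!enumT !big_enum_cond.
  by have := fg x; rewrite -!sum1dep_card => ->.
case/tuple_permP => s fgs; exists s => k.
have {fgs} : [tuple f k | k < n] = [tuple tnth [tuple g k | k < n] (s i) | i < n].
  exact: val_inj.
by move/(congr1 (fun t => tnth t k)); rewrite !tnth_mktuple.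
Qed.

(** Sorting the labels by decreasing multiplicity gives [t], and the sorted multiplicities give [l].
    Then [f] and [t] after the row function have fibres of equal size, so they differ by a
    permutation of positions. *)
Lemma young_row_normal_form n d (f : 'I_n -> 'I_d) :
  exists (l : young n d) (s : {perm 'I_n}) (t : {perm 'I_d}),
    forall k, f k = t (young_rowO l (s k)).
Proof.
pose c i := #|[set k | f k == i]%SET|.
have c_le i : (c i < n.+1)%N.
  by rewrite ltnS -[leqRHS]card_ord max_card.
pose le_c : rel 'I_d := fun i j => (c j <= c i)%N.
have sz : size (sort le_c (enum 'I_d)) == d by rewrite size_sort size_enum_ord.
have : perm_eq (Tuple sz) (ord_tuple d) by rewrite val_ord_tuple /= perm_sort.
case/tuple_permP => t st.
pose mu := [tuple Ordinal (c_le (t i)) | i < d].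
have muE : map val mu = map c (sort le_c (enum 'I_d)).
  rewrite -[sort _ _]/(tval (Tuple sz)) st /= -!map_comp.
  by apply: eq_map => i /=; rewrite tnth_ord_tuple.
have mu_part : is_partition mu.
  rewrite /is_partition muE; apply/andP; split.
    rewrite sorted_map; apply: sort_sorted => i j; exact: leq_total.
  rewrite sumnE big_map (perm_big _ (permEl (perm_sort _ _))) /=.
  rewrite big_enum /= -[X in _ == X]card_ord -sum1_card (partition_big f predT) //=.
  by apply/eqP; apply: eq_bigr => i _; rewrite sum1dep_card.
exists (Young mu_part).
have [] := @perm_of_eq_fibers n _ f (t \o young_rowO (Young mu_part)).
  move=> i; transitivity #|[set k | young_row (Young mu_part) k == (t^-1)%g i]%SET|.
    rewrite card_young_row /young_shape /= (nth_map (Ordinal (c_le i))).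
      by rewrite (nth_map i) ?size_enum_ord //= nth_ord_enum permKV.
    by rewrite size_map size_enum_ord.
  apply: eq_card => k; rewrite !inE /=; apply/eqP/eqP => [ki|<-].
    by rewrite -[RHS](permKV t); congr (t _); apply: val_inj.
  by rewrite permK.
by move=> s fs; exists s, t.
Qed.

Local Open Scope sesquilinear_scope.

(** * Orthogonal projections *)

Section OrthogonalProjections.
Variable C : numClosedFieldType.

Lemma adjmxM m n p (A : 'M[C]_(m, n)) (B : 'M[C]_(n, p)) :
  (A *m B)^t* = B^t* *m A^t*.
Proof. by rewrite trmx_mul map_mxM. Qed.

Lemma adjmx_sum m n I (r : seq I) (P : pred I) (F : I -> 'M[C]_(m, n)) :
  (\sum_(i <- r | P i) F i)^t* = \sum_(i <- r | P i) (F i)^t*.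
Proof. by rewrite !raddf_sum. Qed.

Lemma mxtrace_mul_adj m n (A : 'M[C]_(m, n)) :
  \tr (A *m A^t*) = \sum_i \sum_j `|A i j| ^+ 2.
Proof.
rewrite /mxtrace; apply: eq_bigr => i _; rewrite mxE.
by apply: eq_bigr => j _; rewrite !mxE normCK.
Qed.

Lemma mxtrace_mul_adj_eq0 m n (A : 'M[C]_(m, n)) :
  (\tr (A *m A^t*) == 0) = (A == 0).
Proof.
apply/eqP/eqP => [|->]; last by rewrite mul0mx mxtrace0.
rewrite mxtrace_mul_adj => A0; apply/matrixP => i j; rewrite mxE.
move: A0 => /eqP; rewrite psumr_eq0; last first.
  by move=> k _; apply: sumr_ge0 => l _; rewrite exprn_ge0.
move=> /allP/(_ i); rewrite mem_index_enum => /(_ isT)/implyP/(_ isT).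
rewrite psumr_eq0; last by move=> l _; rewrite exprn_ge0.
move=> /allP/(_ j); rewrite mem_index_enum => /(_ isT)/implyP/(_ isT).
by rewrite sqrf_eq0 normr_eq0 => /eqP.
Qed.

(** The row spaces of Q and 1 - Q are orthogonal, so Q equals Q times its adjoint, which is
    self-adjoint. *)
Lemma proj_ortho_adj p n (W : 'M[C]_(p, n)) : (proj_ortho W)^t* = proj_ortho W.
Proof.
set Q := proj_ortho W.
have /orthomx1P Q_ortho : (Q <= orthomx Num.conj (mx_of_hermitian (hermitian1mx _))
    (1%:M - 1%:M *m Q))%MS.
  rewrite orthomx_sym (submx_trans (proj_ortho_compl_sub _ _)) //.
  by rewrite submx_ortho -{1}[Q]mul1mx proj_ortho_sub.
have QQ : Q = Q *m Q^t*.
  apply/eqP; rewrite -subr_eq0 -[X in X - _]mulmx1 -mulmxBr -Q_ortho mul1mx.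
  by rewrite [(1%:M - Q)^T]linearB /= map_mxB trmx1 map_mx1.
by rewrite QQ adjmxM trmxCK.
Qed.

(** Stability under [A] gives QAQ = QA; stability under the adjoint gives, after taking adjoints,
    QAQ = AQ. *)
Lemma proj_ortho_comm p n (W : 'M[C]_(p, n)) (A : 'M[C]_n) :
  (W *m A <= W)%MS -> (W *m A^t* <= W)%MS -> proj_ortho W *m A = A *m proj_ortho W.
Proof.
move=> WA WA'; set Q := proj_ortho W; have Q_adj : Q^t* = Q := proj_ortho_adj W.
have stable (B : 'M[C]_n) : (W *m B <= W)%MS -> Q *m B *m Q = Q *m B.
  move=> WB; apply: proj_ortho_id; apply: submx_trans WB.
  by rewrite submxMr // -[Q]mul1mx proj_ortho_sub.
have := stable _ WA'; have := stable _ WA.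
clearbody Q => QA /(congr1 (fun M : 'M[C]_n => M^t*)).
rewrite !adjmxM trmxCK Q_adj mulmxA => <-.
by rewrite QA.
Qed.

Lemma proj_ortho_mul0 p q n (W : 'M[C]_(p, n)) (W' : 'M[C]_(q, n)) :
  W *m W'^t* = 0 -> proj_ortho W *m proj_ortho W' = 0.
Proof.
move=> WW'; rewrite -[proj_ortho W']proj_ortho_adj.
have /submxP[A ->] : (proj_ortho W <= W)%MS by rewrite -[X in (X <= _)%MS]mul1mx proj_ortho_sub.
have /submxP[B ->] : (proj_ortho W' <= W')%MS by rewrite -[X in (X <= _)%MS]mul1mx proj_ortho_sub.
by rewrite adjmxM -!mulmxA [X in _ *m X]mulmxA WW' mul0mx mulmx0.
Qed.

Definition herm_re n (X : 'M[C]_n) : 'M[C]_n := 2^-1 *: (X + X^t*).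
(** With Y the adjoint of X this is (X - Y) / (2i), the imaginary part in the Cartesian
    decomposition. *)
Definition herm_im n (X : 'M[C]_n) : 'M[C]_n := 2^-1 *: ('i *: X^t* - 'i *: X).

Lemma herm_re_adj n (X : 'M[C]_n) : (herm_re X)^t* = herm_re X.
Proof.
apply/matrixP => i j; rewrite /herm_re !mxE rmorphM rmorphD /= conjCK fmorphV rmorph_nat.
by rewrite addrC.
Qed.

Lemma herm_im_adj n (X : 'M[C]_n) : (herm_im X)^t* = herm_im X.
Proof.
apply/matrixP => i j; rewrite /herm_im !mxE rmorphM rmorphB !rmorphM /=.
by rewrite conjCK conjCi fmorphV rmorph_nat !mulNr opprK addrC.
Qed.

Lemma herm_decomposition n (X : 'M[C]_n) : X = herm_re X + 'i *: herm_im X.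
Proof.
apply/matrixP => i j; rewrite /herm_re /herm_im !mxE.
have ii : 'i * 'i = -1 :> C by rewrite -expr2 sqrCi.
set u := X i j; set v := (X j i)^*.
transitivity (2^-1 * (u + v) + 2^-1 * (('i * 'i) * v - ('i * 'i) * u)); last by ring.
by rewrite ii; field.
Qed.

End OrthogonalProjections.

Lemma ffun_neqP (I : finType) (T : eqType) (f g : {ffun I -> T}) :
  f != g -> exists k, f k != g k.
Proof.
move=> fg; apply/existsP; rewrite -negb_forall; apply: contraNN fg => /forallP fg.
by apply/eqP/ffunP => k; exact/eqP.
Qed.

(** * Operators on the tensor space *)

Section TensorOperators.
Variables (R : realType) (n d : nat).
Local Notation C := R[i].
Local Notation N := (tdim n d).
Implicit Types (f g : {ffun 'I_n -> 'I_d}) (s t : {perm 'I_n}) (l m : young n d).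

Definition tbasis f : 'I_N := enum_rank f.

Lemma tbasisK : cancel tbasis (@tidx n d).
Proof. exact: enum_rankK. Qed.

Lemma tidxK : cancel (@tidx n d) tbasis.
Proof. exact: enum_valK. Qed.

Lemma sum_tbasis (V : nmodType) (F : 'I_N -> V) :
  \sum_i F i = \sum_f F (tbasis f).
Proof. by rewrite (reindex tbasis) //; exists (@tidx n d) => i _; rewrite (tbasisK, tidxK). Qed.

Lemma tmatrixP (A B : 'M[C]_N) :
  (forall f g, A (tbasis f) (tbasis g) = B (tbasis f) (tbasis g)) -> A = B.
Proof. by move=> AB; apply/matrixP => i j; rewrite -(tidxK i) -(tidxK j). Qed.

(** The operator X_0 (x) ... (x) X_(n-1) with independent factors, to which polarization extends
    statements on tensor powers. *)
Definition tensor_mul (X : 'I_n -> 'M[C]_d) : 'M[C]_N :=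
  \matrix_(i, j) \prod_k X k (tidx i k) (tidx j k).

Lemma tensor_mulE X f g :
  tensor_mul X (tbasis f) (tbasis g) = \prod_k X k (f k) (g k).
Proof. by rewrite mxE !tbasisK. Qed.

Lemma tensor_powerE (A : 'M[C]_d) f g :
  tensor_power n A (tbasis f) (tbasis g) = \prod_k A (f k) (g k).
Proof. by rewrite mxE !tbasisK. Qed.

Lemma tensor_power_mul (A : 'M[C]_d) : tensor_power n A = tensor_mul (fun=> A).
Proof. by []. Qed.

Lemma tensor_powerM (A B : 'M[C]_d) :
  tensor_power n (A *m B) = tensor_power n A *m tensor_power n B.
Proof.
apply: tmatrixP => f g; rewrite tensor_powerE mxE sum_tbasis.
under eq_bigr do rewrite mxE; rewrite bigA_distr_bigA /=.
by apply: eq_bigr => h _; rewrite !tensor_powerE big_split.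
Qed.

Lemma tensor_power_adj (A : 'M[C]_d) : tensor_power n (A^t*) = (tensor_power n A)^t*.
Proof.
apply: tmatrixP => f g; rewrite !mxE !tbasisK rmorph_prod.
by apply: eq_bigr => k _; rewrite !mxE.
Qed.

Lemma tensor_power1 : tensor_power n (1%:M : 'M[C]_d) = 1%:M.
Proof.
apply: tmatrixP => f g; rewrite tensor_powerE mxE (can_eq tbasisK).
have [->|/ffun_neqP[k fgk]] := eqVneq f g.
  by rewrite big1 // => k _; rewrite mxE eqxx.
by rewrite (bigD1 k) //= mxE (negbTE fgk) mul0r.
Qed.

(** The action of [perm_op s] on basis indices: e_f goes to the basis tensor of [fperm f s]. *)
Definition fperm f s : {ffun 'I_n -> 'I_d} := [ffun k => f (s k)].

Lemma fpermM f s t : fperm f (s * t) = fperm (fperm f t) s.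
Proof. by apply/ffunP => k; rewrite !ffunE permM. Qed.

Lemma fpermK s : cancel (fperm^~ s) (fperm^~ s^-1%g).
Proof. by move=> f; apply/ffunP => k; rewrite !ffunE permKV. Qed.

Lemma fpermKV s : cancel (fperm^~ s^-1%g) (fperm^~ s).
Proof. by move=> f; apply/ffunP => k; rewrite !ffunE permK. Qed.

Lemma perm_opE s f g : perm_op R d s (tbasis f) (tbasis g) = (f == fperm g s)%:R.
Proof. by rewrite mxE !tbasisK; congr (_ == _)%:R; apply/ffunP => k; rewrite !ffunE. Qed.

Lemma mulmx_perm_opE (A : 'M[C]_N) s f g :
  (A *m perm_op R d s) (tbasis f) (tbasis g) = A (tbasis f) (tbasis (fperm g s)).
Proof.
rewrite mxE sum_tbasis (bigD1 (fperm g s)) //= perm_opE eqxx mulr1 big1 ?addr0 //.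
by move=> h /negbTE hg; rewrite perm_opE hg mulr0.
Qed.

Lemma perm_op_mulmxE (A : 'M[C]_N) s f g :
  (perm_op R d s *m A) (tbasis f) (tbasis g) = A (tbasis (fperm f s^-1)) (tbasis g).
Proof.
rewrite mxE sum_tbasis (bigD1 (fperm f s^-1)) //= perm_opE fpermKV eqxx mul1r big1 ?addr0 //.
move=> h hf; rewrite perm_opE; case: eqP => [fh|_]; last by rewrite mul0r.
by rewrite fh fpermK eqxx in hf.
Qed.

Lemma perm_opM s t : perm_op R d (s * t)%g = perm_op R d s *m perm_op R d t :> 'M[C]_N.
Proof. by apply: tmatrixP => f g; rewrite mulmx_perm_opE !perm_opE fpermM. Qed.

Lemma perm_op1 : perm_op R d 1%g = 1%:M :> 'M[C]_N.
Proof.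
apply: tmatrixP => f g; rewrite perm_opE mxE (can_eq tbasisK).
by congr (_ == _)%:R; apply/ffunP => k; rewrite !ffunE perm1.
Qed.

Lemma perm_op_adj s : (perm_op R d s)^t* = perm_op R d s^-1%g :> 'M[C]_N.
Proof.
apply: tmatrixP => f g; rewrite [LHS]mxE [X in X^*]mxE !perm_opE conjC_nat.
by congr (nat_of_bool _)%:R; apply/eqP/eqP => ->; rewrite (fpermK, fpermKV).
Qed.

Lemma tensor_mul_perm (X : 'I_n -> 'M[C]_d) s :
  tensor_mul X *m perm_op R d s = perm_op R d s *m tensor_mul (fun k => X (s^-1%g k)).
Proof.
apply: tmatrixP => f g; rewrite mulmx_perm_opE perm_op_mulmxE !tensor_mulE.
by rewrite (reindex_perm s^-1%g); apply: eq_bigr => k _; rewrite !ffunE permKV.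
Qed.

Lemma tensor_power_perm (A : 'M[C]_d) s :
  tensor_power n A *m perm_op R d s = perm_op R d s *m tensor_power n A.
Proof. by rewrite tensor_power_mul tensor_mul_perm. Qed.

End TensorOperators.

(** * Young symmetrizers and Schur-Weyl blocks *)

Section SchurWeylBlocks.
Variables (R : realType) (n d : nat).
Local Notation C := R[i].
Local Notation N := (tdim n d).
Local Notation P := (@perm_op R n d).
Implicit Types (s t : {perm 'I_n}) (l m : young n d).

Definition row_sym l : 'M[C]_N := \sum_(s in row_stab l) P s.
Definition col_sym l : 'M[C]_N := \sum_(s in col_stab l) (-1) ^+ s *: P s.

Lemma row_symM l t : t \in row_stab l -> row_sym l *m P t = row_sym l.
Proof.
move=> tl; rewrite /row_sym mulmx_suml [RHS](reindex_inj (mulIg t)) /=.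
by apply: eq_big => [s|s _]; rewrite ?groupMr // perm_opM.
Qed.

Lemma col_symM l t : t \in col_stab l -> P t *m col_sym l = (-1) ^+ t *: col_sym l.
Proof.
move=> tl; rewrite /col_sym mulmx_sumr scaler_sumr [RHS](reindex_inj (mulgI t)) /=.
apply: eq_big => [s|s _]; rewrite ?groupMl // perm_opM -scalemxAr scalerA.
by rewrite odd_permM signr_addb signrMK.
Qed.

Lemma row_sym_adj l : (row_sym l)^t* = row_sym l.
Proof.
rewrite adjmx_sum [RHS](reindex_inj invg_inj) /=.
by apply: eq_big => [s|s _]; rewrite ?groupV // perm_op_adj.
Qed.

Lemma col_sym_adj l : (col_sym l)^t* = col_sym l.
Proof.
rewrite adjmx_sum [RHS](reindex_inj invg_inj) /=.
apply: eq_big => [s|s _]; rewrite ?groupV //.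
by rewrite linearZ /= map_mxZ perm_op_adj rmorph_sign odd_permV.
Qed.

Lemma young_symmetrizerE l : young_symmetrizer R l = row_sym l *m col_sym l.
Proof. by []. Qed.

Lemma young_symmetrizer_adj l : (young_symmetrizer R l)^t* = col_sym l *m row_sym l.
Proof. by rewrite adjmxM row_sym_adj col_sym_adj. Qed.

(* If two boxes of a row of l go to one column of m, their transposition fixes
   the product and changes its sign. *)
Lemma row_perm_col_neq0 l m s : row_sym l *m P s *m col_sym m != 0 ->
  forall k k', young_row l k = young_row l k' ->
    young_col m (s k) = young_col m (s k') -> k = k'.
Proof.
move=> nz k k' kl km; apply/eqP; apply: contraNT nz => kk'.
have swap (T : eqType) (F : 'I_n -> T) (x y z : 'I_n) : F x = F y -> F (tperm x y z) = F z.
  by move=> Fxy; case: tpermP => [->|->|].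
have tl : tperm k k' \in row_stab l by apply/row_stabP => z; exact: swap.
have tm : tperm (s k) (s k') \in col_stab m by apply/col_stabP => z; exact: swap.
have ts : P (tperm k k') *m P s = P s *m P (tperm (s k) (s k')).
  by rewrite -!perm_opM -tpermJ conjgE mulKVg.
have : row_sym l *m P s *m col_sym m = - (row_sym l *m P s *m col_sym m).
  rewrite -{1}(row_symM tl) -(mulmxA (row_sym l)) ts -!mulmxA (col_symM tm) odd_tperm.
  by rewrite (inj_eq perm_inj) kk' expr1 scaleN1r !mulmxN.
move/eqP; rewrite -addr_eq0 -mulr2n -scaler_nat scaler_eq0 pnatr_eq0 /=.
by [].
Qed.

Lemma dominance_of_neq0 l m s : row_sym l *m P s *m col_sym m != 0 ->
  forall j, (#|[set k | (young_row l k < j)%N]%SET|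
             <= #|[set k | (young_row m k < j)%N]%SET|)%N.
Proof.
move=> nz j; apply: (@leq_card_young_dominance _ _ l m j s); first exact: perm_inj.
exact: row_perm_col_neq0.
Qed.

Lemma tensor_power_young_symmetrizer l (A : 'M[C]_d) :
  tensor_power n A *m young_symmetrizer R l = young_symmetrizer R l *m tensor_power n A.
Proof.
rewrite young_symmetrizerE mulmxA (_ : _ *m row_sym l = row_sym l *m tensor_power n A).
  rewrite -!mulmxA; congr (_ *m _); rewrite mulmx_sumr mulmx_suml.
  by apply: eq_bigr => s _; rewrite -scalemxAr -scalemxAl tensor_power_perm.
rewrite mulmx_sumr mulmx_suml.
by apply: eq_bigr => s _; rewrite tensor_power_perm.
Qed.

Lemma row_sym_sandwich l p q (A : 'M[C]_(p, N)) (B : 'M[C]_(N, q)) :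
  A *m row_sym l *m B = \sum_(s in row_stab l) A *m P s *m B.
Proof. by rewrite mulmx_sumr mulmx_suml. Qed.

(** With a and b the row and column sums, the product is b_m a_m s a_l b_l. Expanding a_l produces
    factors a_m u b_l; expanding a_m produces adjoints of factors a_l v b_m. If the product is
    nonzero, so is some factor of each kind; then [l] and [m] dominate each other and coincide. *)
Lemma young_symmetrizer_ortho l m s : l != m ->
  (young_symmetrizer R m)^t* *m P s *m young_symmetrizer R l = 0.
Proof.
apply: contraNeq; rewrite young_symmetrizer_adj young_symmetrizerE => nz.
have [/existsP[u mul]|] := boolP [exists u, row_sym m *m P u *m col_sym l != 0]; last first.
  rewrite negb_exists => /forallP ml0; case/eqP: nz.
  rewrite mulmxA row_sym_sandwich big1 // => t _.
  rewrite -(mulmxA (col_sym m *m _)) -perm_opM -!(mulmxA (col_sym m)).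
  by have := ml0 (s * t)%g; rewrite negbK => /eqP ->; rewrite mulmx0.
have [/existsP[v lm]|] := boolP [exists u, row_sym l *m P u *m col_sym m != 0]; last first.
  rewrite negb_exists => /forallP lm0; case/eqP: nz.
  rewrite mulmxA -(mulmxA (col_sym m *m _)) row_sym_sandwich mulmx_suml big1 // => t _.
  rewrite mulmxA -[_ *m P t *m _]mulmxA -perm_opM [X in X *m _](_ : _ = 0) ?mul0mx //.
  (* The factor b_m (ts) a_l is the adjoint of a_l (ts)^-1 b_m. *)
  have := lm0 (t * s)^-1%g; rewrite negbK => /eqP/(congr1 (fun M : 'M[C]_N => M^t*)).
  by rewrite !adjmxM row_sym_adj col_sym_adj perm_op_adj invgK mulmxA trmx0 map_mx0.
apply/eqP/eq_young_dominance => j; apply/eqP; rewrite eqn_leq.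
by rewrite (dominance_of_neq0 mul) (dominance_of_neq0 lm).
Qed.

(** Take the diagonal entry at e_f, where f sends a position to its row. The term of s and t
    contributes only if st preserves rows; as s does, so does the column permutation t, whence t =
    1. The entry is the order of the row stabilizer. *)
Lemma young_symmetrizer_neq0 l : young_symmetrizer R l != 0.
Proof.
pose f : {ffun 'I_n -> 'I_d} := [ffun k => young_rowO l k].
apply/eqP => /matrixP/(_ (tbasis f) (tbasis f)); rewrite [RHS]mxE.
rewrite young_symmetrizerE -[row_sym l]mul1mx row_sym_sandwich summxE.
have fE k : f k = young_rowO l k by rewrite ffunE.
clearbody f.
have fixf t : reflect (forall k, f (t k) = f k) (f == fperm f t).
  apply: (iffP eqP) => [ft k|ft]; first by rewrite {2}ft ffunE.
  by apply/ffunP => k; rewrite ffunE ft.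
have row_fix s : s \in row_stab l -> forall k, f (s k) = f k.
  by move=> /row_stabP sl k; rewrite !fE; apply: val_inj; exact: sl.
under eq_bigr => s sl.
  rewrite mul1mx mulmx_sumr summxE (bigD1 1%g) ?group1 //=.
  rewrite odd_perm1 expr0 scale1r perm_op1 mulmx1 perm_opE.
  rewrite (introT (fixf _) (row_fix _ sl)) big1 ?addr0; last first.
    move=> t /andP[tl t1]; rewrite -scalemxAr -perm_opM mxE perm_opE.
    case: fixf => [ft|_]; last by rewrite mulr0.
    case/eqP: t1; apply: row_col_stab1 tl; apply/row_stabP => k.
    have := ft (s^-1%g k); rewrite permM permKV !fE => /(congr1 val) /= ->.
    by have /row_stabP/(_ (s^-1%g k)) := sl; rewrite permKV.
  over.
rewrite /= sumr_const => /eqP; by rewrite pnatr_eq0 (negbTE (lt0n_neq0 (cardG_gt0 _))).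
Qed.

(** On generators the product is the transpose of [c_m^t* P(t^-1 s) c_l]. *)
Lemma schur_weyl_block_ortho l m : l != m ->
  schur_weyl_block R l *m (schur_weyl_block R m)^t* = 0.
Proof.
move=> lm; apply/orthomx1P/sumsmx_subP => s _; rewrite orthomx_sym.
apply/sumsmx_subP => t _; rewrite orthomx_sym; apply/orthomx1P.
have := young_symmetrizer_ortho (t^-1 * s)%g lm.
move: (young_symmetrizer R m) (young_symmetrizer R l) => cm cl.
rewrite perm_opM -perm_op_adj mulmxA -adjmxM -(mulmxA _ (P s)) => /(congr1 trmx).
by rewrite trmx_mul trmx0 -map_trmx.
Qed.

Lemma schur_proj_adj l : (schur_proj R l)^t* = schur_proj R l.
Proof. by rewrite /schur_proj -[in RHS]proj_ortho_adj map_trmx. Qed.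

Lemma schur_proj_idem l : schur_proj R l *m schur_proj R l = schur_proj R l.
Proof. by rewrite -trmx_mul proj_ortho_proj. Qed.

Lemma schur_proj_mul0 l m : l != m -> schur_proj R l *m schur_proj R m = 0.
Proof.
move=> lm; rewrite -trmx_mul proj_ortho_mul0 ?trmx0 //.
by rewrite schur_weyl_block_ortho // eq_sym.
Qed.

(** The block contains the nonzero column space of c_l, which a zero projection could not fix. *)
Lemma schur_proj_neq0 l : schur_proj R l != 0.
Proof.
apply: contraNneq (young_symmetrizer_neq0 l) => pl0.
rewrite -[young_symmetrizer R l]mul1mx -perm_op1 -trmx_eq0.
rewrite -[X in X == 0](proj_ortho_id (U := schur_weyl_block R l)) ?(sumsmx_sup 1%g) //.
by rewrite -[proj_ortho _]trmxK -/(schur_proj R l) pl0 trmx0 mulmx0.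
Qed.

Lemma schur_weyl_block_stable l (A : 'M[C]_N) :
    (forall s, exists t B, A *m P s *m young_symmetrizer R l = P t *m young_symmetrizer R l *m B) ->
  (schur_weyl_block R l *m A^T <= schur_weyl_block R l)%MS.
Proof.
move=> As; rewrite sumsmxMr; apply/sumsmx_subP => s _.
have [t [B AB]] := As s.
rewrite -trmx_mul mulmxA AB trmx_mul (submx_trans (submxMl _ _)) //.
by rewrite (sumsmx_sup t).
Qed.

Lemma schur_proj_comm l (A : 'M[C]_N) :
    (schur_weyl_block R l *m A^T <= schur_weyl_block R l)%MS ->
    (schur_weyl_block R l *m (A^t*)^T <= schur_weyl_block R l)%MS ->
  schur_proj R l *m A = A *m schur_proj R l.
Proof.
move=> lA lA'; apply: trmx_inj; rewrite !trmx_mul trmxK.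
by apply/esym/proj_ortho_comm; [exact: lA | rewrite -map_trmx].
Qed.

Lemma schur_proj_perm l s : schur_proj R l *m P s = P s *m schur_proj R l.
Proof.
have stable u : (schur_weyl_block R l *m (P u)^T <= schur_weyl_block R l)%MS.
  apply: schur_weyl_block_stable => t; exists (u * t)%g, 1%:M.
  by rewrite mulmx1 perm_opM.
by apply: schur_proj_comm; rewrite ?perm_op_adj stable.
Qed.

(** Tensor powers commute with permutations and with c_l, so they preserve the block; the adjoint of
    a tensor power is again one, which gives the second stability condition. *)
Lemma schur_proj_tensor_power l (A : 'M[C]_d) :
  schur_proj R l *m tensor_power n A = tensor_power n A *m schur_proj R l.
Proof.
have stable B : (schur_weyl_block R l *m (tensor_power n B)^T <= schur_weyl_block R l)%MS.
  apply: schur_weyl_block_stable => t; exists t, (tensor_power n B).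
  by rewrite tensor_power_perm -mulmxA -[RHS]mulmxA tensor_power_young_symmetrizer.
by apply: schur_proj_comm; rewrite -?tensor_power_adj stable.
Qed.

End SchurWeylBlocks.

(** * The center *)

Section Commutant.
Variables (R : realType) (n d : nat).
Local Notation C := R[i].
Local Notation N := (tdim n d).
Local Notation P := (@perm_op R n d).
Implicit Types (f g : {ffun 'I_n -> 'I_d}) (s : {perm 'I_n}) (T : 'M[C]_N).

(** The common commutant of the two actions; by Schur-Weyl duality it is the center of the algebra
    generated by either one. *)
Definition schur_weyl_center T : Prop :=
  (forall s, T *m P s = P s *m T) /\
  (forall U : 'M[C]_d, U \is unitarymx -> T *m tensor_power n U = tensor_power n U *m T).

Lemma center_fperm T f g s : schur_weyl_center T ->
  T (tbasis (fperm f s)) (tbasis (fperm g s)) = T (tbasis f) (tbasis g).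
Proof.
by case=> TP _; rewrite -mulmx_perm_opE TP perm_op_mulmxE fpermK.
Qed.

Definition flabel (t : {perm 'I_d}) f : {ffun 'I_n -> 'I_d} := [ffun k => t (f k)].

Lemma flabelK t : cancel (flabel t) (flabel t^-1).
Proof. by move=> f; apply/ffunP => k; rewrite !ffunE permK. Qed.

Lemma perm_mx_unitary (t : {perm 'I_d}) : (perm_mx t : 'M[C]_d) \is unitarymx.
Proof.
by apply/unitarymxP; rewrite tr_perm_mx map_perm_mx -perm_mxM mulgV perm_mx1.
Qed.

Lemma tensor_power_perm_mxE t f g :
  tensor_power n (perm_mx t : 'M[C]_d) (tbasis f) (tbasis g) = (flabel t f == g)%:R.
Proof.
rewrite tensor_powerE; have [<-|/ffun_neqP[k fgk]] := eqVneq (flabel t f) g.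
  by rewrite big1 // => k _; rewrite !mxE ffunE eqxx.
by rewrite ffunE in fgk; rewrite (bigD1 k) //= !mxE (negbTE fgk) mul0r.
Qed.

Lemma center_flabel T f g t : schur_weyl_center T ->
  T (tbasis (flabel t f)) (tbasis (flabel t g)) = T (tbasis f) (tbasis g).
Proof.
case=> _ /(_ _ (perm_mx_unitary t)) /matrixP/(_ (tbasis f) (tbasis (flabel t g))).
rewrite !mxE !sum_tbasis (bigD1 g) //= tensor_power_perm_mxE eqxx mulr1 big1 ?addr0; last first.
  move=> h /negbTE hg; rewrite tensor_power_perm_mxE (can_eq (flabelK t)) hg.
  by rewrite mulr0.
rewrite (bigD1 (flabel t f)) //= tensor_power_perm_mxE eqxx mul1r big1 ?addr0 //.
by move=> h /negbTE hf; rewrite tensor_power_perm_mxE eq_sym hf mul0r.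
Qed.

(** A basis tensor of weight [l]; permuting positions and labels of these gives all basis
    tensors. *)
Definition young_tensor (l : young n d) : {ffun 'I_n -> 'I_d} := [ffun k => young_rowO l k].

Lemma center_diag_eq0 T f : schur_weyl_center T ->
  (forall l, T (tbasis (young_tensor l)) (tbasis (young_tensor l)) = 0) ->
  T (tbasis f) (tbasis f) = 0.
Proof.
move=> cT T0; have [l [s [t fE]]] := young_row_normal_form f.
have -> : f = flabel t (fperm (young_tensor l) s) by apply/ffunP => k; rewrite !ffunE fE.
by rewrite center_flabel // center_fperm.
Qed.

Lemma trace_diag_tensor_power T (D : 'rV[C]_d) :
    (forall f, T (tbasis f) (tbasis f) = 0) ->
  \tr (tensor_power n (diag_mx D) *m T) = 0.
Proof.
move=> T0; rewrite /mxtrace sum_tbasis big1 // => f _.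
rewrite mxE sum_tbasis (bigD1 f) //= T0 mulr0 add0r big1 // => g /ffun_neqP[k fgk].
by rewrite tensor_powerE (bigD1 k) //= mxE eq_sym (negbTE fgk) mulr0n !mul0r.
Qed.

(** Diagonalize X by a unitary V. Since T commutes with V^(x)n and the trace is cyclic, X may be
    replaced by its diagonal form. *)
Lemma trace_hermitian_tensor_power T (X : 'M[C]_d) : schur_weyl_center T ->
    (forall f, T (tbasis f) (tbasis f) = 0) -> X^t* = X ->
  \tr (tensor_power n X *m T) = 0.
Proof.
move=> [_ TU] T0 XX; have /orthomx_spectralP -> : X \is normalmx.
  by apply/normalmxP; rewrite XX.
have VU := spectral_unitarymx X.
rewrite invmx_unitary // !tensor_powerM -mulmxA -TU // mxtrace_mulC -!mulmxA.
rewrite [tensor_power n _ *m (_ *m _)]mulmxA -tensor_powerM (unitarymxP VU).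
by rewrite tensor_power1 mul1mx mxtrace_mulC trace_diag_tensor_power.
Qed.

Lemma tensor_mul_sum (I : finType) (A : {set I}) (Y : I -> 'I_n -> 'M[C]_d) :
  tensor_mul (fun k => \sum_(i in A) Y i k) =
  \sum_(p : {ffun 'I_n -> I} | [forall k, p k \in A]) tensor_mul (fun k => Y (p k) k).
Proof.
apply: tmatrixP => f g; rewrite tensor_mulE summxE.
under eq_bigr do rewrite summxE.
rewrite bigA_distr_big.
by apply: eq_big => [p|p _]; rewrite ?tensor_mulE.
Qed.

(** Conjugation by [P s] permutes the tensor factors and fixes [T]. *)
Lemma trace_tensor_mul_perm T (X : 'I_n -> 'M[C]_d) s : schur_weyl_center T ->
  \tr (tensor_mul (fun k => X (s k)) *m T) = \tr (tensor_mul X *m T).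
Proof.
move=> [TP _]; have XP : tensor_mul (fun k => X (s k)) *m P s = P s *m tensor_mul X.
  rewrite tensor_mul_perm; congr (_ *m _); apply: tmatrixP => f g.
  by rewrite !tensor_mulE; apply: eq_bigr => k _; rewrite permKV.
rewrite -[tensor_mul X]mul1mx -perm_op1 -(mulVg s) perm_opM -(mulmxA _ (P s)) -XP.
rewrite -!mulmxA -TP [RHS]mxtrace_mulC -!mulmxA -perm_opM mulgV perm_op1 mulmx1.
by [].
Qed.

(* Inclusion-exclusion: the coefficient of a map p is the alternating sum over
   the sets containing its range. *)
Lemma polarization (X : 'I_n -> 'M[C]_d) :
  \sum_(A : {set 'I_n}) (-1) ^+ #|A| *: tensor_power n (\sum_(j in A) X j) =
  (-1) ^+ n *: \sum_(p : {ffun 'I_n -> 'I_n} | injectiveb p) tensor_mul (fun k => X (p k)).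
Proof.
under eq_bigr do rewrite tensor_power_mul tensor_mul_sum scaler_sumr big_mkcond /=.
rewrite exchange_big scaler_sumr [RHS]big_mkcond /=; apply: eq_bigr => p _.
rewrite -big_mkcond -scaler_suml.
(* The alternating sum over sets A containing the range of p factors over j: membership in A
   contributes -1, and non-membership contributes 1 if j is outside the range and 0 otherwise. *)
transitivity ((\prod_j (-1 + (j \notin codom p)%:R : C)) *: tensor_mul (fun k => X (p k))).
  congr (_ *: _); rewrite bigA_distr big_mkcond; apply: eq_bigr => A _.
  case: forallP => [pA|/forallP].
    rewrite (bigID (mem A)) /= [X in _ * X]big1 ?mulr1.
      rewrite -prodr_const; apply: eq_bigr => j ->; done.
    move=> j jA; rewrite (negbTE jA); case: codomP => [[k jk]|] //.
    by rewrite jk pA in jA.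
  rewrite negb_forall => /existsP[k kA].
  by rewrite (bigD1 (p k)) //= (negbTE kA) codom_f mul0r.
(* For injective, hence bijective, p every factor is -1; otherwise a missed j gives the factor -1 +
   1 = 0. *)
case: injectiveP => [p_inj|].
  congr (_ *: _); rewrite -[in RHS](card_ord n) -cardsT -prodr_const.
  apply: eq_big => j; rewrite ?inE // => _.
  have [q _ qK] := injF_bij p_inj.
  by rewrite -[j]qK codom_f addr0.
move=> p_ninj; have /existsP[j jp] : [exists j, j \notin codom p].
  rewrite -negb_forall; apply/forallP => p_surj; apply: p_ninj.
  apply/injectiveP/card_uniqP; rewrite size_map size_enum_ord -[RHS]card_ord.
  by apply: eq_card => j; rewrite p_surj inE.
by rewrite (bigD1 j) //= jp addNr mul0r scale0r.
Qed.

(** On the left of [polarization] each term is a tensor power of a hermitian matrix, with zero trace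
    against [T]. On the right each injective p is a permutation, so all terms have the same trace,
    and there is at least one. *)
Lemma trace_hermitian_tensor_mul T (X : 'I_n -> 'M[C]_d) : schur_weyl_center T ->
    (forall f, T (tbasis f) (tbasis f) = 0) -> (forall k, (X k)^t* = X k) ->
  \tr (tensor_mul X *m T) = 0.
Proof.
move=> cT T0 XX; have := congr1 (fun M => \tr (M *m T)) (polarization X).
rewrite /= mulmx_suml raddf_sum /= big1; last first.
  move=> A _; rewrite -scalemxAl mxtraceZ trace_hermitian_tensor_power ?mulr0 //.
  by rewrite adjmx_sum; apply: eq_bigr.
rewrite -scalemxAl mxtraceZ mulmx_suml raddf_sum /=.
rewrite (eq_bigr (fun=> \tr (tensor_mul X *m T))) => [|p /injectiveP p_inj]; last first.
  rewrite -(trace_tensor_mul_perm X (perm p_inj) cT); congr (\tr (_ *m _)).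
  apply: tmatrixP => f g; rewrite !tensor_mulE.
  by apply: eq_bigr => k _; rewrite permE.
rewrite sumr_const => /esym/eqP; rewrite mulf_eq0 signr_eq0 /= mulrn_eq0.
case/orP => [|/eqP //]; rewrite -leqn0 leqNgt => /negP[]; apply/card_gt0P.
by exists [ffun k => k]; apply/injectiveP => x y; rewrite !ffunE.
Qed.

Lemma tensor_mulZ (a : 'I_n -> C) (X : 'I_n -> 'M[C]_d) :
  tensor_mul (fun k => a k *: X k) = (\prod_k a k) *: tensor_mul X.
Proof.
apply: tmatrixP => f g; rewrite tensor_mulE [RHS]mxE tensor_mulE -big_split.
by apply: eq_bigr => k _; rewrite mxE.
Qed.

(** Splitting every factor into hermitian parts and expanding multilinearly leaves tensor products
    of hermitian matrices. *)
Lemma trace_tensor_mul T (X : 'I_n -> 'M[C]_d) : schur_weyl_center T ->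
    (forall f, T (tbasis f) (tbasis f) = 0) -> \tr (tensor_mul X *m T) = 0.
Proof.
move=> cT T0.
pose a (b : bool) : C := if b then 'i else 1.
pose H (b : bool) k : 'M[C]_d := if b then herm_im (X k) else herm_re (X k).
have XE : tensor_mul X = tensor_mul (fun k => \sum_(b in [set: bool]%SET) a b *: H b k).
  apply: tmatrixP => f g; rewrite !tensor_mulE; apply: eq_bigr => k _.
  rewrite (eq_bigl predT) => [|b]; last by rewrite inE.
  by rewrite big_bool /= scale1r addrC -herm_decomposition.
rewrite XE tensor_mul_sum mulmx_suml raddf_sum big1 //= => p _.
rewrite tensor_mulZ -scalemxAl mxtraceZ trace_hermitian_tensor_mul ?mulr0 // => k.
by rewrite /H; case: (p k); rewrite (herm_im_adj, herm_re_adj).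
Qed.

(** The matrix unit at row g and column f is a tensor product of matrix units; its trace against [T]
    is the entry of [T] at f, g. *)
Lemma center_eq0 T : schur_weyl_center T ->
    (forall l, T (tbasis (young_tensor l)) (tbasis (young_tensor l)) = 0) -> T = 0.
Proof.
move=> cT Tl0; have T0 f := center_diag_eq0 f cT Tl0.
apply: tmatrixP => f g; rewrite [RHS]mxE.
rewrite -[RHS](trace_tensor_mul (fun k => delta_mx (g k) (f k)) cT T0).
have -> : tensor_mul (fun k => delta_mx (g k) (f k) : 'M[C]_d) = delta_mx (tbasis g) (tbasis f).
  apply: tmatrixP => h h'; rewrite tensor_mulE mxE !(can_eq (@tbasisK n d)).
  have [->|/ffun_neqP[k hgk]] /= := eqVneq h g; last first.
    by rewrite (bigD1 k) //= mxE (negbTE hgk) mul0r.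
  have [->|/ffun_neqP[k hfk]] /= := eqVneq h' f.
    by rewrite big1 // => k _; rewrite mxE !eqxx.
  by rewrite (bigD1 k) //= mxE (negbTE hfk) andbF mul0r.
rewrite /mxtrace (bigD1 (tbasis g)) //= mxE (bigD1 (tbasis f)) //= mxE !eqxx mul1r.
rewrite !big1 ?addr0 // => i /negbTE ig; last by rewrite mxE ig andbF mul0r.
by rewrite mxE big1 // => j _; rewrite mxE ig mul0r.
Qed.

End Commutant.

(** * Expansion of the center in the Schur-Weyl projections *)

Lemma lincomb_ortho_idemM (K : comNzRingType) (I : finType) N (p : I -> 'M[K]_N)
    (k : I -> K) (j : I) :
    (forall i, p i *m p i = p i) -> (forall i i', i != i' -> p i *m p i' = 0) ->
  (\sum_i k i *: p i) *m p j = k j *: p j.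
Proof.
move=> p_idem p_ortho; rewrite mulmx_suml (bigD1 j) //= -scalemxAl p_idem.
by rewrite big1 ?addr0 // => i ij; rewrite -scalemxAl p_ortho // scaler0.
Qed.

Section CenterExpansion.
Variables (R : realType) (n d : nat).
Local Notation C := R[i].
Local Notation N := (tdim n d).
Local Notation P := (@perm_op R n d).
Local Notation center := (@schur_weyl_center R n d).
Implicit Types (l m : young n d) (T M : 'M[C]_N).

Lemma schur_proj_center l : center (schur_proj R l).
Proof.
by split => [s|U _]; [exact: schur_proj_perm | exact: schur_proj_tensor_power].
Qed.

Lemma center1 : center 1%:M.
Proof. by split => *; rewrite mul1mx mulmx1. Qed.

Lemma center_lincomb (I : finType) (k : I -> C) (T_ : I -> 'M[C]_N) :
  (forall i, center (T_ i)) -> center (\sum_i k i *: T_ i).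
Proof.
move=> cT; split => [s|U Uu]; rewrite mulmx_suml mulmx_sumr; apply: eq_bigr => i _.
  by rewrite -scalemxAl -scalemxAr (proj1 (cT i)).
by rewrite -scalemxAl -scalemxAr (proj2 (cT i)).
Qed.

Lemma center_sub T T' : center T -> center T' -> center (T - T').
Proof.
move=> [TP TU] [TP' TU']; split => [s|U Uu]; rewrite mulmxBl mulmxBr.
  by rewrite TP TP'.
by rewrite TU ?TU'.
Qed.

Lemma lincomb_schur_projM (k : young n d -> C) m :
  (\sum_l k l *: schur_proj R l) *m schur_proj R m = k m *: schur_proj R m.
Proof.
by apply: lincomb_ortho_idemM; [exact: schur_proj_idem|exact: schur_proj_mul0].
Qed.

Lemma mxtrace_schur_proj_neq0 l : \tr (schur_proj R l) != 0.
Proof.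
by rewrite -schur_proj_idem -{2}schur_proj_adj mxtrace_mul_adj_eq0 schur_proj_neq0.
Qed.

(* The central matrices embed into the functions on young n d by center_eq0, and
   the nonzero orthogonal projections already span a space of that dimension. *)
Lemma center_spanned T : center T ->
  exists k : young n d -> C, T = \sum_l k l *: schur_proj R l.
Proof.
move=> cT.
pose phi T := \row_(j < #|{: young n d}|)
  T (tbasis (young_tensor (enum_val j))) (tbasis (young_tensor (enum_val j))).
have phi0 T' : center T' -> phi T' = 0 -> T' = 0.
  move=> cT' /rowP T'0; apply: center_eq0 => // l.
  by have := T'0 (enum_rank l); rewrite !mxE enum_rankK.
pose A := \matrix_(i < #|{: young n d}|) phi (schur_proj R (enum_val i)).
pose comb (v : 'rV[C]_#|{: young n d}|) := \sum_l v 0 (enum_rank l) *: schur_proj R l.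
have comb_center v : center (comb v) by apply: center_lincomb => l; exact: schur_proj_center.
have phi_comb v : phi (comb v) = v *m A.
  apply/rowP => j; rewrite !mxE summxE [RHS](reindex (@enum_rank (young n d))) /=.
    by apply: eq_bigr => l _; rewrite !mxE enum_rankK.
  exact/onW_bij/enum_rank_bij.
(* If v A = 0 then [comb v] = 0, and multiplying by each projection kills each coefficient; the
   square matrix A is thus invertible. *)
have A_unit : A \in unitmx.
  rewrite -row_free_unit; apply: inj_row_free => v; rewrite -phi_comb => /phi0 v0.
  apply/rowP => j; rewrite mxE; apply/eqP.
  have := lincomb_schur_projM (fun l => v 0 (enum_rank l)) (enum_val j).
  rewrite -/(comb v) v0 // mul0mx enum_valK => /esym/eqP.
  by rewrite scaler_eq0 (negbTE (schur_proj_neq0 R _)) orbF.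
(* This choice gives [comb v] and T the same image under [phi]. *)
pose v := phi T *m invmx A; exists (fun l => v 0 (enum_rank l)).
apply/eqP; rewrite -subr_eq0; apply/eqP/phi0; first exact: center_sub cT (comb_center v).
have -> : phi (T - comb v) = phi T - phi (comb v) by apply/rowP => j; rewrite !mxE.
by rewrite phi_comb mulmxKV // subrr.
Qed.

(** Multiplying by one projection isolates its coefficient, and the trace reads it off. *)
Lemma center_expansion T : center T ->
  T = \sum_l (\tr (T *m schur_proj R l) / \tr (schur_proj R l)) *: schur_proj R l.
Proof.
case/center_spanned => k ->; apply: eq_bigr => l _.
by rewrite lincomb_schur_projM mxtraceZ mulfK // mxtrace_schur_proj_neq0.
Qed.

(** Completeness of the blocks comes from expanding the identity, which is central. *)
Lemma sum_schur_proj : \sum_l schur_proj R l = 1%:M :> 'M[C]_N.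
Proof.
rewrite [RHS]center_expansion; last exact: center1.
apply: eq_bigr => l _.
by rewrite mul1mx divff ?scale1r // mxtrace_schur_proj_neq0.
Qed.

Lemma trace_tensor_power_expansion M (rho : 'M[C]_d) :
    (forall U : 'M[C]_d, U \is unitarymx -> (tensor_power n U)^t* *m M *m tensor_power n U = M) ->
  \tr (tensor_power n rho *m M) =
  \sum_l (\tr (M *m schur_proj R l) / \tr (schur_proj R l)) *
         \tr (tensor_power n rho *m schur_proj R l).
Proof.
move=> MU; have MUc U : U \is unitarymx -> M *m tensor_power n U = tensor_power n U *m M.
  move=> Uu; rewrite -{2}(MU U Uu) !mulmxA -tensor_power_adj -tensor_powerM.
  by rewrite (unitarymxP Uu) tensor_power1 mul1mx.
(* The average over S_n is left unnormalized: traces against operators commuting with permutations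
   are multiplied by n!. *)
pose T : 'M[C]_N := \sum_(s : {perm 'I_n}) P s^-1 *m M *m P s.
have cT : center T.
  split => [t|U Uu]; rewrite mulmx_suml mulmx_sumr.
    rewrite [RHS](reindex_inj (mulIg t)) /=; apply: eq_bigr => s _.
    by rewrite !perm_opM invMg perm_opM !mulmxA -perm_opM mulgV perm_op1 mul1mx.
  apply: eq_bigr => s _; move: (MUc _ Uu) (tensor_power_perm U s) (tensor_power_perm U s^-1).
  move: (tensor_power n U) => V MV sV s'V.
  by rewrite -!mulmxA -sV (mulmxA M) MV -(mulmxA V) mulmxA -s'V -!mulmxA.
have trT (B : 'M[C]_N) : (forall s, B *m P s = P s *m B) ->
    \tr (T *m B) = \tr (M *m B) *+ #|{perm 'I_n}|.
  move=> BP; rewrite mulmx_suml raddf_sum /= -sumr_const; apply: eq_bigr => s _.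
  rewrite -!mulmxA -BP mxtrace_mulC -!mulmxA -perm_opM mulgV perm_op1 mulmx1.
  by [].
have := congr1 (fun X => \tr (X *m tensor_power n rho)) (center_expansion cT).
rewrite /= trT; last by move=> s; rewrite tensor_power_perm.
rewrite mulmx_suml raddf_sum /= mxtrace_mulC => trE.
have m_gt0 : (0 < #|{perm 'I_n}|)%N by apply/card_gt0P; exists 1%g.
(* Both sides carry the factor n!, which cancels. *)
apply: (pmulrnI m_gt0); rewrite trE -sumrMnl; apply: eq_bigr => l _.
rewrite -scalemxAl mxtraceZ trT; last by move=> s; rewrite schur_proj_perm.
by rewrite [\tr (schur_proj R l *m _)]mxtrace_mulC -!mulrnAl.
Qed.

End CenterExpansion.

(** * Positive matrices *)

Section PositiveMatrices.
Variable C : numClosedFieldType.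

Lemma mulmx_delta_entry n (A : 'M[C]_n) i j :
  ((delta_mx i 0 : 'cV[C]_n)^t* *m A *m (delta_mx j 0 : 'cV[C]_n)) 0 0 = A i j.
Proof.
rewrite -mulmxA mxE (bigD1 i) //= !mxE !eqxx conjC1 mul1r (bigD1 j) //= mxE !eqxx mulr1.
rewrite !big1 ?addr0 // => k /negbTE ki; first by rewrite !mxE ki conjC0 mul0r.
by rewrite mxE ki mulr0.
Qed.

(** Complex polarization: x + y gives b x y + b y x = 0, and x + iy gives b x y - b y x = 0. *)
Lemma quad_form_eq0 n (A : 'M[C]_n) :
  (forall x : 'cV[C]_n, (x^t* *m A *m x) 0 0 = 0) -> A = 0.
Proof.
move=> A0; pose b (x y : 'cV[C]_n) : C := (x^t* *m A *m y) 0 0.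
have bD (x y x' y' : 'cV[C]_n) (a : C) : b (x + a *: y) (x' + a *: y') =
    b x x' + a * b x y' + a^* * b y x' + a^* * a * b y y'.
  rewrite /b (_ : (x + a *: y)^t* = x^t* + a^* *: y^t*); last first.
    by apply/matrixP => i j; rewrite !mxE rmorphD rmorphM.
  rewrite !mulmxDl !mulmxDr -!scalemxAl -!scalemxAr.
  move: (x^t* *m A *m x') (x^t* *m A *m y') (y^t* *m A *m x') (y^t* *m A *m y') => p q r s.
  by rewrite !mxE; ring.
have sym0 x y : b x y + b y x = 0.
  have := bD x y x y 1; rewrite !/b !A0 conjC1 !mul1r => /esym.
  by rewrite add0r addr0.
have skew0 x y : b x y - b y x = 0.
  have := bD x y x y 'i; rewrite !/b !A0 conjCi mulr0 add0r addr0 mulNr -mulrBr.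
  by move=> /esym/eqP; rewrite mulf_eq0 (negbTE (neq0Ci C)) => /eqP.
apply/matrixP => i j; rewrite mxE -mulmx_delta_entry.
have := congr2 +%R (sym0 (delta_mx i 0) (delta_mx j 0)) (skew0 (delta_mx i 0) (delta_mx j 0)).
rewrite addrACA subrr !addr0 -mulr2n => /eqP; rewrite mulrn_eq0 /=.
by move=> /eqP.
Qed.

(** The form takes real values, so the form of A minus its adjoint vanishes. *)
Lemma quad_form_ge0_adj n (A : 'M[C]_n) :
  (forall x : 'cV[C]_n, 0 <= (x^t* *m A *m x) 0 0) -> A^t* = A.
Proof.
move=> A0; apply/eqP; rewrite -subr_eq0; apply/eqP/quad_form_eq0 => x.
have : ((x^t* *m A *m x)^t*) 0 0 = (x^t* *m A *m x) 0 0.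
  have /CrealP qx := ger0_real (A0 x).
  by move: (x^t* *m A *m x) qx => q qx; rewrite !mxE.
rewrite !adjmxM trmxCK mulmxA mulmxBr mulmxBl.
by move: (_ *m x) (_ *m x) => p q pq; rewrite !mxE pq subrr.
Qed.

(** By the spectral theorem B is the root of the diagonal part times V; the eigenvalues are
    nonnegative, being values of the form at the columns of the adjoint of V. *)
Lemma quad_form_ge0_square n (A : 'M[C]_n) :
  (forall x : 'cV[C]_n, 0 <= (x^t* *m A *m x) 0 0) -> exists B : 'M[C]_n, A = B^t* *m B.
Proof.
move=> A0; have A_adj := quad_form_ge0_adj A0.
have A_spectral : A = invmx (spectralmx A) *m diag_mx (spectral_diag A) *m spectralmx A.
  by apply/orthomx_spectralP/normalmxP; rewrite A_adj.
set V := spectralmx A in A_spectral; set D := spectral_diag A in A_spectral.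
have VU : V \is unitarymx by exact: spectral_unitarymx.
have D_ge0 i : 0 <= D 0 i.
  have := A0 (V^t* *m (delta_mx i 0)); rewrite adjmxM trmxCK.
  rewrite A_spectral invmx_unitary // !mulmxA -(mulmxA _ V) (unitarymxP VU) mulmx1.
  rewrite -(mulmxA _ V) (unitarymxP VU) mulmx1 mulmx_delta_entry.
  by rewrite mxE eqxx mulr1n.
exists (diag_mx (map_mx sqrtC D) *m V).
rewrite adjmxM A_spectral invmx_unitary // mulmxA -[in RHS](mulmxA (V^t*)); congr (_ *m _ *m _).
rewrite tr_diag_mx map_diag_mx mulmx_diag; congr diag_mx; apply/rowP => i.
have /CrealP D_real : sqrtC (D 0 i) \is Num.real by rewrite ger0_real // sqrtC_ge0.
by rewrite !mxE /= D_real -expr2 sqrtCK.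
Qed.

Lemma mxtrace_mul_sandwich n (A Q : 'M[C]_n) :
  Q *m Q = Q -> \tr (Q *m A *m Q) = \tr (A *m Q).
Proof. by move=> QQ; rewrite mxtrace_mulC mulmxA QQ mxtrace_mulC. Qed.

(** The trace equals that of QAQ, whose diagonal entries are values of the form at Q e_i. *)
Lemma quad_form_trace_ge0 n (A Q : 'M[C]_n) :
    (forall x : 'cV[C]_n, 0 <= (x^t* *m A *m x) 0 0) -> Q^t* = Q -> Q *m Q = Q ->
  0 <= \tr (A *m Q).
Proof.
move=> A0 Q_adj QQ; rewrite -mxtrace_mul_sandwich //; apply: sumr_ge0 => i _.
rewrite -mulmx_delta_entry; have := A0 (Q *m delta_mx i 0).
by rewrite adjmxM Q_adj !mulmxA.
Qed.

Lemma orthoproj_quad_form_ge0 n (Q : 'M[C]_n) (x : 'cV[C]_n) :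
  Q^t* = Q -> Q *m Q = Q -> 0 <= (x^t* *m Q *m x) 0 0.
Proof.
move=> Q_adj QQ; rewrite -QQ -{1}Q_adj mulmxA -adjmxM -mulmxA mxE.
by apply: sumr_ge0 => i _; rewrite !mxE mulrC mul_conjC_ge0.
Qed.

Lemma mxtrace_orthoproj_ge0 n (Q : 'M[C]_n) : Q^t* = Q -> Q *m Q = Q -> 0 <= \tr Q.
Proof.
move=> Q_adj QQ; apply: sumr_ge0 => i _; rewrite -mulmx_delta_entry.
exact: orthoproj_quad_form_ge0.
Qed.

End PositiveMatrices.

(** * Discrete outcome spaces and integrals against atomic measures *)

Import numFieldNormedType.Exports.
Local Open Scope classical_set_scope.

HB.saturate discrete_topology.

(** The diagonal is an entourage, so a Cauchy filter has a member contained in a singleton. *)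
Lemma discrete_cauchy_cvg (T : pointedType) 
    (F : set_system (discrete_topology T : puniformType)) :
  ProperFilter F -> cauchy F -> cvg F.
Proof.
move=> FF /(_ (range (fun x => (x, x)))) [].
  by rewrite uniform_discrete => x.
move=> [A B] /= [FA FB] AB.
have [x [Ax Bx]] := filter_ex (filterI FA FB).
apply: (cvgP (x : discrete_topology T : puniformType)).
apply/(@discrete_cvg (discrete_topology T)); apply: filterS FA => y Ay.
by have [z _ [-> ->]] := AB (y, x) (conj Ay Bx).
Qed.

HB.instance Definition _ (T : pointedType) :=
  Uniform_isComplete.Build (discrete_topology T) (@discrete_cauchy_cvg T).

Lemma standard_borel_young (R : realType) n d : standard_borel R (young n d.+1).
Proof.
pose D : pointedType := young n d.+1.
exists (discrete_topology D : completePseudoMetricType R); split.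
- exact: discrete_hausdorff.
- exists setT; last by move=> O [x Ox] _; exists x.
  apply: finite_set_countable; exact: (@finite_finset (young n d.+1) setT).
exists id; first by exists id.
move=> B; split=> // _; apply: sub_sigma_algebra; exact: discrete_open.
Qed.

(** Here [mu] is a bare set function; it is first identified with a finite sum of scaled Dirac
    measures. *)
Lemma integral_sum_dirac (R : realType) dT (T : measurableType dT) (s : seq T)
    (w : T -> {nonneg R}) (mu : set T -> \bar R) (f : T -> \bar R) :
    (forall B, mu B = \sum_(x <- s) ((w x)%:num%:E * \d_x B)%E)%E ->
    (forall x, 0 <= f x)%E -> measurable_fun [set: T] f ->
  (\int[mu]_x f x = \sum_(x <- s) (w x)%:num%:E * f x)%E.
Proof.
(* The empty list is treated apart because [nth] needs a default point. *)
move=> muE f0 mf; case: s => [|x0 s'] in muE *.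
  rewrite big_nil; have -> : mu = mzero by apply/funext => B; rewrite muE big_nil.
  exact: integral_measure_zero.
set s := x0 :: s' in muE *.
pose m k : {measure set T -> \bar R} := mscale (w (nth x0 s k)) \d_(nth x0 s k).
have -> : mu = msum m (size s).
  by apply/funext => B; rewrite muE (big_nth x0) big_mkord.
rewrite (ge0_integral_measure_sum m) // (big_nth x0) big_mkord; apply: eq_bigr => k _.
by rewrite ge0_integral_mscale // integral_dirac // diracT mul1e.
Qed.

Lemma Re_mxtrace_sum (R : realType) m (I : Type) (r : seq I) (P : pred I) (A : I -> 'M[R[i]]_m) :
  complex.Re (\tr (\sum_(i <- r | P i) A i)) = \sum_(i <- r | P i) complex.Re (\tr (A i)).
Proof. by rewrite (big_morph _ (@mxtraceD _ m) (@mxtrace0 _ m)) raddf_sum. Qed.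

(** * Probability kernels of a POVM *)

Lemma cvg_Re (R : realType) (u : nat -> R[i]^o) (l : R[i]^o) :
  u @ \oo --> l -> (fun k => complex.Re (u k)) @ \oo --> complex.Re l.
Proof.
move=> ul; apply/cvgrPdist_lt => e e_gt0.
have eC_gt0 : 0 < e%:C%C :> R[i] by rewrite ltcR.
move/cvgrPdist_lt: ul => /(_ _ eC_gt0); apply: filterS => k; rewrite -ltcR.
by apply: le_lt_trans; rewrite -raddfB; exact: normc_ge_Re.
Qed.

Section PovmProbability.
Variables (R : realType) (m : nat) (dY : measure_display) (Y : measurableType dY).
Variables (M : set Y -> 'M[R[i]]_m) (Q : 'M[R[i]]_m).
Hypothesis M_povm : is_povm M.

(** The trace against [Q] is a finite sum of matrix elements between e_j and Q e_j, so weak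
    countable additivity applies. *)
Lemma cvg_povm_trace (F : nat -> set Y) :
    (forall k, measurable (F k)) -> trivIset [set: nat] F ->
  (fun k => \sum_(i < k) complex.Re (\tr (M (F i) *m Q))) @ \oo -->
    complex.Re (\tr (M (\bigcup_k F k) *m Q)).
Proof.
move=> mF tF; have [_ _ _ M_add] := M_povm.
have trE (A : 'M[R[i]]_m) : complex.Re (\tr (A *m Q)) =
    \sum_j complex.Re (((delta_mx j 0 : 'cV_m)^t* *m A *m (Q *m (delta_mx j 0 : 'cV_m))) 0 0).
  rewrite -raddf_sum; congr complex.Re; apply: eq_bigr => j _.
  by rewrite -mulmx_delta_entry !mulmxA.
under eq_fun do rewrite -Re_mxtrace_sum -mulmx_suml trE.
rewrite trE.
by apply: cvg_big => [|j _]; [exact: add_continuous|exact/cvg_Re/M_add].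
Qed.

Hypotheses (Q_ge0 : forall B, measurable B -> 0 <= \tr (M B *m Q)) (trQ : \tr Q = 1).

(** The value 0 on nonmeasurable sets makes the function nonnegative everywhere, as a measure
    requires, while the POVM is constrained only on measurable sets. *)
Definition povm_mass (B : set Y) : \bar R :=
  if `[< measurable B >] then (complex.Re (\tr (M B *m Q)))%:E else 0%E.

Lemma povm_massE B : measurable B -> povm_mass B = (complex.Re (\tr (M B *m Q)))%:E.
Proof. by move=> mB; rewrite /povm_mass; case: asboolP. Qed.

Let povm_mass0 : povm_mass set0 = 0%E.
Proof.
rewrite povm_massE //; congr _%:E; set r := complex.Re _.
(* The empty set is a disjoint union of copies of itself, and a convergent series of constant terms
   r has r = 0. *)
have : (fun k => \sum_(i < k) r) @ \oo --> r.
  have := @cvg_povm_trace (fun=> set0) (fun=> measurable0) (@trivIset_set0 _ _ _).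
  by rewrite bigcup0.
move=> cvg_r; have /cvg_series_cvg_0 : cvgn (series (fun=> r)).
  apply/cvg_ex; exists r; apply: cvg_trans cvg_r.
  by apply: near_eq_cvg; apply: nearW => k; rewrite /series /= big_mkord.
move/cvg_lim => <- //; first by rewrite lim_cst.
Qed.

Let povm_mass_ge0 B : (0 <= povm_mass B)%E.
Proof.
rewrite /povm_mass; case: asboolP => // mB.
by rewrite lee_fin -lecR RRe_real ?ger0_real // Q_ge0.
Qed.

Let povm_mass_additive : semi_sigma_additive povm_mass.
Proof.
move=> F mF tF mUF; rewrite povm_massE //.
apply: cvg_EFin.
  by apply: nearW => k; apply/sum_fin_numP => i _ _; rewrite povm_massE.
apply: cvg_trans (cvg_povm_trace mF tF); apply: near_eq_cvg; apply: nearW => k /=.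
under [in RHS]eq_bigr do rewrite povm_massE //.
by rewrite sumEFin /= big_mkord.
Qed.

HB.instance Definition _ := isMeasure.Build _ _ _ povm_mass
  povm_mass0 povm_mass_ge0 povm_mass_additive.

Let povm_massT : povm_mass [set: Y] = 1%E.
Proof. by have [_ _ MT _] := M_povm; rewrite povm_massE // MT mul1mx trQ. Qed.

HB.instance Definition _ := Measure_isProbability.Build _ _ _ povm_mass povm_massT.

Lemma povm_probability : exists mu : probability Y R,
  forall B, measurable B -> mu B = (complex.Re (\tr (M B *m Q)))%:E.
Proof. by exists povm_mass; exact: povm_massE. Qed.

End PovmProbability.

(** * Kernels from Young diagrams *)

Section DiscreteKernel.
Variables (R : realType) (n d : nat) (dY : measure_display) (Y : measurableType dY).
Variable mu : young n d.+1 -> probability Y R.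

Definition young_kernel (l : young n d.+1) : {measure set Y -> \bar R} := mu l.

Let measurable_young_kernel (U : set Y) :
  measurable U -> measurable_fun [set: young n d.+1] (young_kernel ^~ U).
Proof. by []. Qed.

HB.instance Definition _ := isKernel.Build _ _ _ _ _ young_kernel measurable_young_kernel.

Let young_kernelT l : young_kernel l [set: Y] = 1%E.
Proof. exact: probability_setT. Qed.

HB.instance Definition _ := Kernel_isProbability.Build _ _ _ _ _ young_kernel young_kernelT.

Lemma young_kernelP : exists K : R.-pker (young n d.+1) ~> Y, forall l B, K l B = mu l B.
Proof. by exists young_kernel. Qed.

End DiscreteKernel.

(** * Weak Schur sampling *)

Section WeakSchurSampling.
Variables (R : realType) (n d : nat).
Local Notation C := R[i].
Local Notation N := (tdim n d.+1).
Local Notation D := d.+1.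
Implicit Types (l : young n D).

(** There are finitely many diagrams, so the largest index needed to reach them serves as a common
    bound. *)
Lemma eventually_bigcup (F : nat -> set (young n D)) :
  \forall m \near \oo, forall l, (\bigcup_k F k) l -> exists2 k, (k < m)%N & F k l.
Proof.
have /boolp.choice[k kP] l : exists i, (\bigcup_i F i) l -> F i l.
  by have [[i _ Fi]|nF] := pselect ((\bigcup_i F i) l); [exists i|exists 0%N].
exists (\max_l (k l).+1) => // m /= km l /kP Fl; exists (k l) => //.
by apply: leq_trans km; exact: (@leq_bigmax _ (fun l => (k l).+1) l).
Qed.

Lemma weak_schur_sampling_additive (F : nat -> set (young n D)) :
    trivIset [set: nat] F ->
  \forall m \near \oo, \sum_(k < m) weak_schur_sampling R n D (F k) =
    weak_schur_sampling R n D (\bigcup_k F k).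
Proof.
move=> tF; have := eventually_bigcup F; apply: filterS => m Fm.
rewrite /weak_schur_sampling; under eq_bigr do rewrite big_mkcond.
rewrite exchange_big [RHS]big_mkcond /=; apply: eq_bigr => l _.
case: ifPn => [/set_mem /Fm [k km Fkl]|/negP lF].
  rewrite (bigD1 (Ordinal km)) //= mem_set // big1 ?addr0 // => i ik.
  case: ifPn => // /set_mem Fil; case/eqP: ik; apply: val_inj => /=.
  by apply: tF => //; exists l.
rewrite big1 // => i _; case: ifPn => // /set_mem Fil; case: lF; apply/mem_set.
by exists (val i).
Qed.

Lemma weak_schur_sampling_povm : is_povm (weak_schur_sampling R n D).
Proof.
split; first exact: standard_borel_young.
- move=> B _ x; rewrite mulmx_sumr mulmx_suml summxE; apply: sumr_ge0 => l _.
  by apply: orthoproj_quad_form_ge0; [exact: schur_proj_adj|exact: schur_proj_idem].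
- rewrite /weak_schur_sampling -sum_schur_proj.
  by apply: eq_bigl => l; rewrite in_setT.
move=> F _ tF x y; apply: cvg_near_cst.
by have := weak_schur_sampling_additive tF; apply: filterS => m ->.
Qed.

Lemma weak_schur_sampling_invariant : invariant_povm R n D (weak_schur_sampling R n D).
Proof.
split; first exact: weak_schur_sampling_povm.
move=> U Uu B _; rewrite mulmx_sumr mulmx_suml; apply: eq_bigr => l _.
rewrite -mulmxA schur_proj_tensor_power mulmxA -tensor_power_adj -tensor_powerM.
by rewrite (mulmx1C (unitarymxP Uu)) tensor_power1 mul1mx.
Qed.

(** Writing rho as the adjoint of A times A exhibits rho^(x)n as the same square built from A^(x)n,
    hence positive. *)
Lemma tensor_power_schur_ge0 (rho : 'M[C]_D) l : density_op rho ->
  0 <= \tr (tensor_power n rho *m schur_proj R l).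
Proof.
move=> [rho_ge0 _]; have [A ->] := quad_form_ge0_square rho_ge0.
rewrite tensor_powerM tensor_power_adj.
apply: quad_form_trace_ge0; [move=> x|exact: schur_proj_adj|exact: schur_proj_idem].
rewrite mulmxA -adjmxM -mulmxA mxE.
by apply: sumr_ge0 => i _; rewrite !mxE mulrC mul_conjC_ge0.
Qed.

Lemma outcome_law_weak_schur (sigma : 'M[C]_N) (B : set (young n D)) :
  outcome_law sigma (weak_schur_sampling R n D) B =
  (\sum_l ((complex.Re (\tr (sigma *m schur_proj R l)))%:E * \d_l B))%E.
Proof.
rewrite /outcome_law /weak_schur_sampling mulmx_sumr Re_mxtrace_sum.
rewrite -sumEFin big_mkcond /=.
apply: eq_bigr => l _; rewrite diracE; case: ifP => _; last by rewrite mule0.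
by rewrite mule1.
Qed.

(** The maximally mixed state on the block of [l]; the kernel is the outcome law of the POVM in this
    state. *)
Definition schur_state l : 'M[C]_N := (\tr (schur_proj R l))^-1 *: schur_proj R l.

Lemma mxtrace_mul_schur_state (A : 'M[C]_N) l :
  \tr (A *m schur_state l) = \tr (A *m schur_proj R l) / \tr (schur_proj R l).
Proof. by rewrite /schur_state -scalemxAr mxtraceZ mulrC. Qed.

Lemma povm_schur_state_ge0 (dY : measure_display) (Y : measurableType dY)
    (M : set Y -> 'M[C]_N) l B :
  is_povm M -> measurable B -> 0 <= \tr (M B *m schur_state l).
Proof.
move=> [_ M_ge0 _ _] mB; rewrite mxtrace_mul_schur_state divr_ge0 //; last first.
  by apply: mxtrace_orthoproj_ge0; [exact: schur_proj_adj|exact: schur_proj_idem].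
by apply: quad_form_trace_ge0; [exact: M_ge0|exact: schur_proj_adj|exact: schur_proj_idem].
Qed.

Lemma povm_kernel (dY : measure_display) (Y : measurableType dY)
    (M : set Y -> 'M[C]_N) : is_povm M ->
  exists K : R.-pker (young n D) ~> Y, forall l B, measurable B ->
    K l B = (complex.Re (\tr (M B *m schur_state l)))%:E.
Proof.
move=> M_povm; have mu l : exists mu : probability Y R, forall B, measurable B ->
    mu B = (complex.Re (\tr (M B *m schur_state l)))%:E.
  apply: povm_probability => // [B|]; first exact: povm_schur_state_ge0.
  by rewrite mxtraceZ mulVf // mxtrace_schur_proj_neq0.
have [f fP] := boolp.choice mu; have [K KP] := young_kernelP f.
by exists K => l B mB; rewrite KP fP.
Qed.

Lemma invariant_povm_trace (dY : measure_display) (Y : measurableType dY)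
    (M : set Y -> 'M[C]_N) (rho : 'M[C]_D) B :
    invariant_povm R n D M -> measurable B ->
  \tr (tensor_power n rho *m M B) =
  \sum_l (complex.Re (\tr (M B *m schur_state l)))%:C%C *
         \tr (tensor_power n rho *m schur_proj R l).
Proof.
move=> [M_povm MU] mB; rewrite trace_tensor_power_expansion; last by move=> U /MU; exact.
(* Taking the real part loses nothing, as the coefficient is nonnegative. *)
apply: eq_bigr => l _; rewrite RRe_real ?ger0_real ?povm_schur_state_ge0 //.
by rewrite mxtrace_mul_schur_state.
Qed.

Lemma integral_outcome_law_weak_schur (rho : 'M[C]_D) (f : young n D -> \bar R) :
    density_op rho -> (forall l, 0 <= f l)%E ->
  (\int[outcome_law (tensor_power n rho) (weak_schur_sampling R n D)]_l f l =
   \sum_l (complex.Re (\tr (tensor_power n rho *m schur_proj R l)))%:E * f l)%E.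
Proof.
move=> rho_state f_ge0.
have w_ge0 l : 0 <= complex.Re (\tr (tensor_power n rho *m schur_proj R l)).
  by rewrite -lecR RRe_real ?ger0_real // tensor_power_schur_ge0.
pose w l : {nonneg R} := NngNum (w_ge0 l).
rewrite (@integral_sum_dirac R _ (young n D) (index_enum (young n D)) w) // => B.
exact: outcome_law_weak_schur.
Qed.

End WeakSchurSampling.

Local Open Scope complex_scope.

Theorem theorem5p1 (R : realType) (n d : nat) (hn : (0 < n)%N) :
  qc_sufficient (tensor_power_states R n d.+1) (@invariant_povm R n d.+1)
    (weak_schur_sampling R n d.+1) /\
  (forall (dY : measure_display) (Y : measurableType dY)
      (N : set Y -> 'M[R[i]]_(tdim n d.+1)),
    invariant_povm R n d.+1 N ->
    exists K : R.-pker (young n d.+1) ~> Y,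
      forall rho : 'M[R[i]]_d.+1, density_op rho ->
      forall B : set Y, measurable B ->
        \tr (tensor_power n rho *m N B) =
        \sum_(l : young n d.+1)
          (fine (K l B))%:C * \tr (tensor_power n rho *m schur_proj R l)).
Proof.
split.
  split; first exact: weak_schur_sampling_invariant.
  move=> dY Y L L_inv; have [L_povm _] := L_inv.
  have [K KE] := povm_kernel L_povm.
  exists K => [[rho rho_state]] B mB; rewrite /tensor_power_states /=.
  rewrite integral_outcome_law_weak_schur //.
  rewrite /outcome_law (invariant_povm_trace _ L_inv mB) raddf_sum -sumEFin.
  apply: eq_bigr => l _; rewrite KE // -EFinM; congr _%:E.
  (* The kernel value c is real, so the real part of c z is c times that of z. *)
  move: (complex.Re (\tr (L B *m _))) => c; case: (\tr _) => a b /=.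
  by rewrite mul0r subr0 mulrC.
move=> dY Y M M_inv; have [M_povm _] := M_inv.
have [K KE] := povm_kernel M_povm.
exists K => rho _ B mB; rewrite (invariant_povm_trace _ M_inv mB).
by apply: eq_bigr => l _; rewrite KE.
Qed.
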